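(* Let $n\geqslant 0$ be an integer, let $I^n\subset\mathbb{R}^n$ be a closed cube of real dimension $n$, and let $\mathcal{F}$ be a sheaf of abelian groups defined in a neighborhood of $I^n$ in $\mathbb{R}^n$. Then $$H^p(I^n,\mathcal{F})=0$$ for every integer $p>n$.
   Context: A closed cube of real dimension $n$ is a subset of $\mathbb{R}^n$ of the form $I^n=\prod_{i=1}^n[a_i,b_i]=\{x\in\mathbb{R}^n: a_i\leqslant x_i\leqslant b_i,\ 1\leqslant i\leqslant n\}$, where $a_i<b_i$ are finite real numbers for each $i$; for $n=0$, $I^0$ is a point. $H^p(I^n,\mathcal{F})$ denotes the sheaf cohomology of the topological space $I^n$ with coefficients in the restriction $\mathcal{F}|_{I^n}$ (inverse image of $\mathcal{F}$ under the inclusion of $I^n$). *)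

(* Defs.v *)
From HB Require Import structures.
From mathcomp Require Import all_boot all_order all_algebra.
From mathcomp Require Import all_classical all_reals all_analysis.

Set Implicit Arguments.
Unset Strict Implicit.
Unset Printing Implicit Defensive.

Import Order.TTheory GRing.Theory Num.Theory.
Import numFieldNormedType.Exports.
Local Open Scope classical_set_scope.
Local Open Scope quotient_scope.
Local Open Scope ring_scope.

(* Sheaf cohomology is defined after Godement: H^p(X, F) is the p-th
   cohomology group of the complex of global sections of the canonical flabby
   resolution of F.  Abelian groups are zmodTypes. *)

(* The product of the groups T i over the i in A. *)
Section Families.

Definition pfam_of (I : Type) (A : set I) (T : I -> zmodType) : Type :=
  forall i, A i -> T i.

Variables (I : Type) (A : set I) (T : I -> zmodType).
Notation pfam := (pfam_of A T).

HB.instance Definition _ := gen_eqMixin pfam.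
HB.instance Definition _ := gen_choiceMixin pfam.

Definition pfam_zero : pfam := fun i _ => 0.
Definition pfam_opp (s : pfam) : pfam := fun i h => - s i h.
Definition pfam_add (s t : pfam) : pfam := fun i h => s i h + t i h.

Lemma pfamP (s t : pfam) : (forall i h, s i h = t i h) -> s = t.
Proof.
by move=> e; apply: functional_extensionality_dep => i;
  apply: functional_extensionality_dep => h; exact: e.
Qed.

Lemma pfam_addA : associative pfam_add.
Proof. by move=> s t u; apply: pfamP => i h; exact: addrA. Qed.
Lemma pfam_addC : commutative pfam_add.
Proof. by move=> s t; apply: pfamP => i h; exact: addrC. Qed.
Lemma pfam_add0 : left_id pfam_zero pfam_add.
Proof. by move=> s; apply: pfamP => i h; exact: add0r. Qed.
Lemma pfam_addN : left_inverse pfam_zero pfam_opp pfam_add.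
Proof. by move=> s; apply: pfamP => i h; exact: addNr. Qed.

HB.instance Definition _ :=
  GRing.isZmodule.Build pfam pfam_addA pfam_addC pfam_add0 pfam_addN.

End Families.

Section Cokernel.
Variables (A B : zmodType) (f : {additive A -> B}).

Definition im_pred : {pred B} := fun y => `[< exists x, f x = y >].

Lemma im_pred_zmod_closed : zmod_closed im_pred.
Proof.
split; first by apply/asboolP; exists 0; rewrite raddf0.
move=> _ _ /asboolP[x <-] /asboolP[y <-].
by apply/asboolP; exists (x - y); rewrite raddfB.
Qed.
HB.instance Definition _ := GRing.isZmodClosed.Build B im_pred
  im_pred_zmod_closed.

Definition coker : zmodType :=
  @Quotient.quot B (GRing.ZmodClosed.clone B im_pred _).

Definition coker_proj : {additive B -> coker} := \pi_coker.

Lemma coker_proj_eqP (a b : B) :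
  coker_proj a = coker_proj b <-> exists x, f x = a - b.
Proof.
have e : (\pi_coker a == \pi_coker b) = (a - b \in im_pred).
  exact: eqmodE.
split=> [/eqP|h]; first by rewrite e => /asboolP.
by apply/eqP; rewrite e; apply/asboolP.
Qed.

Lemma coker_proj_im (x : A) : coker_proj (f x) = 0.
Proof.
rewrite -(raddf0 coker_proj); apply/coker_proj_eqP.
by exists x; rewrite subr0.
Qed.

Lemma coker_proj_surj (c : coker) : exists a, c = coker_proj a.
Proof. by exists (repr c); rewrite /= reprK. Qed.

End Cokernel.

(* The homology ker g / im f of A -f-> B -g-> C. *)
Section Homology.
Variables (A B C : zmodType) (f : {additive A -> B}) (g : {additive B -> C}).

Definition ker_pred : {pred B} := fun y => g y == 0.

Lemma ker_pred_zmod_closed : zmod_closed ker_pred.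
Proof.
split; first by rewrite unfold_in raddf0.
move=> x y; rewrite !unfold_in raddfB => /eqP-> /eqP->.
by rewrite subr0.
Qed.
HB.instance Definition _ := GRing.isZmodClosed.Build B ker_pred
  ker_pred_zmod_closed.

Record ker := Ker { ker_val : B; _ : ker_val \in ker_pred }.
HB.instance Definition _ := [isSub for ker_val].
HB.instance Definition _ := [Choice of ker by <:].
HB.instance Definition _ := [SubChoice_isSubZmodule of ker by <:].

Definition bound_pred : {pred ker} := fun z => `[< exists x, f x = \val z >].

Lemma bound_pred_zmod_closed : zmod_closed bound_pred.
Proof.
split; first by apply/asboolP; exists 0; rewrite !raddf0.
move=> u v /asboolP[x hx] /asboolP[y hy].
by apply/asboolP; exists (x - y); rewrite !raddfB hx hy.
Qed.
HB.instance Definition _ := GRing.isZmodClosed.Build ker bound_pred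
  bound_pred_zmod_closed.

Definition homology : zmodType :=
  @Quotient.quot ker (GRing.ZmodClosed.clone ker bound_pred _).

End Homology.

Section Presheaves.

Record opens (X : topologicalType) :=
  Opens { carrier :> set X; carrier_open : open carrier }.

Identity Coercion set_fun : set >-> Funclass.

Definition opensT (X : topologicalType) : opens X := Opens openT.
Definition opensI (X : topologicalType) (U V : opens X) : opens X :=
  Opens (openI (carrier_open U) (carrier_open V)).

Lemma opensIl (X : topologicalType) (U V : opens X) : opensI U V `<=` U.
Proof. exact: subIsetl. Qed.
Lemma opensIr (X : topologicalType) (U V : opens X) : opensI U V `<=` V.
Proof. exact: subIsetr. Qed.

Record presheaf (X : topologicalType) := Presheaf {
  sections :> opens X -> zmodType;
  res : forall U V : opens X, V `<=` U -> {additive sections U -> sections V};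
  res_id : forall (U : opens X) (h : U `<=` U) s, res h s = s;
  res_comp : forall (U V W : opens X) (hVU : V `<=` U) (hWV : W `<=` V)
    (hWU : W `<=` U) s, res hWV (res hVU s) = res hWU s }.

Arguments res {X} F {U V} h : rename.

Lemma res_irr (X : topologicalType) (F : presheaf X) (U V : opens X)
  (h h' : V `<=` U) (s : F U) : res F h s = res F h' s.
Proof. by rewrite (Prop_irrelevance h h'). Qed.

Definition is_sheaf (X : topologicalType) (F : presheaf X) : Prop :=
  forall (U : opens X) (I : Type) (V : I -> opens X)
    (hV : forall i, V i `<=` U), U `<=` \bigcup_i V i ->
  forall s : forall i, F (V i),
    (forall i j, res F (@opensIl _ (V i) (V j)) (s i) =
                 res F (@opensIr _ (V i) (V j)) (s j)) ->
  exists! t : F U, forall i, res F (hV i) t = s i.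

Record sheaf (X : topologicalType) :=
  Sheaf { sheaf_val :> presheaf X; sheafP : is_sheaf sheaf_val }.

Record hom (X : topologicalType) (F G : presheaf X) := Hom {
  hom_val :> forall U : opens X, {additive F U -> G U};
  hom_res : forall (U V : opens X) (h : V `<=` U) (s : F U),
    hom_val V (res F h s) = res G h (hom_val U s) }.

End Presheaves.

Section HomComp.
Variables (X : topologicalType) (F G K : presheaf X).
Variables (psi : hom G K) (phi : hom F G).

Definition hom_comp_val (U : opens X) : {additive F U -> K U} :=
  psi U \o phi U.

Lemma hom_comp_res (U V : opens X) (h : V `<=` U) (s : F U) :
  hom_comp_val V (res F h s) = res K h (hom_comp_val U s).
Proof. by rewrite /= !hom_res. Qed.

Definition hom_comp : hom F K := Hom hom_comp_res.

End HomComp.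

(* [germs F A] is the direct limit of the groups F V over the open sets V
   containing A. *)
Section Germs.
Variables (X : topologicalType) (F : presheaf X) (A : set X).

Record pregerm := Pregerm
  { pg_dom : opens X; pg_sub : A `<=` pg_dom; pg_val : F pg_dom }.
HB.instance Definition _ := gen_eqMixin pregerm.
HB.instance Definition _ := gen_choiceMixin pregerm.

Definition same_germ : rel pregerm := fun s t =>
  `[< exists (W : opens X) (hs : W `<=` pg_dom s) (ht : W `<=` pg_dom t),
        A `<=` W /\ res F hs (pg_val s) = res F ht (pg_val t) >].

Lemma same_germ_equiv : equiv_class_of same_germ.
Proof.
split.
- move=> s; apply/asboolP.
  have h : pg_dom s `<=` pg_dom s by [].
  by exists (pg_dom s), h, h; split; [exact: pg_sub|].
- move=> s t; apply/asboolP/asboolP => -[W [hs [ht [AW e]]]];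
  by exists W, ht, hs.
- move=> t s u /asboolP[W [hs [ht [AW e]]]] /asboolP[W' [ht' [hu [AW' e']]]].
  apply/asboolP.
  have hW : opensI W W' `<=` W by exact: subIsetl.
  have hW' : opensI W W' `<=` W' by exact: subIsetr.
  have hs' := subset_trans hW hs.
  have hu' := subset_trans hW' hu.
  exists (opensI W W'), hs', hu'; split.
    by move=> x Ax; split; [exact: AW|exact: AW'].
  rewrite -(res_comp hs hW) -(res_comp hu hW') e -e'.
  have h : opensI W W' `<=` pg_dom t by exact: subset_trans hW ht.
  by rewrite !(res_comp _ _ h).
Qed.

Canonical same_germ_equivRel := EquivRelPack same_germ_equiv.
Canonical same_germ_encModRel := defaultEncModRel same_germ.

Definition germs : Type := {eq_quot same_germ}.
HB.instance Definition _ : EqQuotient pregerm same_germ germs :=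
  EqQuotient.on germs.
HB.instance Definition _ := Choice.on germs.

Definition pg0 : pregerm := @Pregerm (opensT X) (@subsetT _ A) 0.
Definition pgN (s : pregerm) : pregerm := Pregerm (@pg_sub s) (- pg_val s).
Definition pgD (s t : pregerm) : pregerm :=
  @Pregerm (opensI (pg_dom s) (pg_dom t))
    (fun x Ax => conj (pg_sub s Ax) (pg_sub t Ax))
    (res F (@opensIl _ _ _) (pg_val s) + res F (@opensIr _ _ _) (pg_val t)).

Lemma germsP (s t : pregerm) (W : opens X) (hs : W `<=` pg_dom s)
    (ht : W `<=` pg_dom t) : A `<=` W ->
  res F hs (pg_val s) = res F ht (pg_val t) -> \pi_germs s = \pi_germs t.
Proof. by move=> AW e; apply/eqmodP/asboolP; exists W, hs, ht. Qed.

Definition germs0 : germs := lift_cst germs pg0.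
Definition germsN := lift_op1 germs pgN.
Definition germsD := lift_op2 germs pgD.

Canonical pi_germs0_morph := PiConst germs0.

Lemma pi_germsN : {morph \pi : s / pgN s >-> germsN s}.
Proof.
move=> s; unlock germsN.
have /eqmodP/asboolP[W [hs [ht [AW e]]]] : s = repr (\pi_germs s) %[mod germs].
  by rewrite reprK.
by apply: (@germsP (pgN s) (pgN (repr (\pi_germs s))) W hs ht AW);
  rewrite /= !raddfN e.
Qed.
Canonical pi_germsN_morph := PiMorph1 pi_germsN.

Lemma pi_germsD : {morph \pi : s t / pgD s t >-> germsD s t}.
Proof.
move=> s t; unlock germsD.
set s' := repr (\pi_germs s); set t' := repr (\pi_germs t).
have /eqmodP/asboolP[W [hs [hs' [AW e]]]] : s = s' %[mod germs].
  by rewrite reprK.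
have /eqmodP/asboolP[W' [ht [ht' [AW' e']]]] : t = t' %[mod germs].
  by rewrite reprK.
have hW : opensI W W' `<=` W by exact: subIsetl.
have hW' : opensI W W' `<=` W' by exact: subIsetr.
have h1 : opensI W W' `<=` pg_dom (pgD s t).
  by move=> x [/hs sx /ht tx]; split.
have h2 : opensI W W' `<=` pg_dom (pgD s' t').
  by move=> x [/hs' sx /ht' tx]; split.
apply: (germsP (hs := h1) (ht := h2)).
  by move=> x Ax; split; [exact: AW|exact: AW'].
rewrite /= !raddfD /=.
have r1 : opensI W W' `<=` pg_dom s by exact: subset_trans hW hs.
have r2 : opensI W W' `<=` pg_dom t by exact: subset_trans hW' ht.
have r3 : opensI W W' `<=` pg_dom s' by exact: subset_trans hW hs'.
have r4 : opensI W W' `<=` pg_dom t' by exact: subset_trans hW' ht'.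
rewrite (res_comp _ _ r1) (res_comp _ _ r2) (res_comp _ _ r3) (res_comp _ _ r4).
rewrite -(res_comp hs hW) -(res_comp ht hW') e e'.
by rewrite (res_comp hs' hW r3) (res_comp ht' hW' r4).
Qed.
Canonical pi_germsD_morph := PiMorph2 pi_germsD.

Lemma germsDA : associative germsD.
Proof.
elim/quotW => s; elim/quotW => t; elim/quotW => u; rewrite !piE.
have r0 : pg_dom (pgD s (pgD t u)) `<=` pg_dom (pgD (pgD s t) u).
  by move=> x [? [? ?]].
apply: (germsP (hs := @subset_refl _ _) (ht := r0)); first exact: pg_sub.
rewrite res_id /= !raddfD /= addrA.
have r1 : pg_dom (pgD s (pgD t u)) `<=` pg_dom s by move=> x [? [? ?]].
have r2 : pg_dom (pgD s (pgD t u)) `<=` pg_dom t by move=> x [? [? ?]].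
have r3 : pg_dom (pgD s (pgD t u)) `<=` pg_dom u by move=> x [? [? ?]].
have r4 : pg_dom (pgD (pgD s t) u) `<=` pg_dom s by move=> x [[? ?] ?].
have r5 : pg_dom (pgD (pgD s t) u) `<=` pg_dom t by move=> x [[? ?] ?].
rewrite (res_comp _ _ r4) (res_comp _ _ r5).
rewrite (res_comp _ _ r1) !(res_comp _ _ r2) !(res_comp _ _ r3).
by rewrite (res_irr _ r1).
Qed.

Lemma germsDC : commutative germsD.
Proof.
elim/quotW => s; elim/quotW => t; rewrite !piE.
have r0 : pg_dom (pgD s t) `<=` pg_dom (pgD t s) by move=> x [].
apply: (germsP (hs := @subset_refl _ _) (ht := r0)); first exact: pg_sub.
have r1 : pg_dom (pgD s t) `<=` pg_dom s by move=> x [].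
have r2 : pg_dom (pgD s t) `<=` pg_dom t by move=> x [].
by rewrite res_id /= raddfD /= (res_comp _ _ r1) (res_comp _ _ r2) addrC
  (res_irr _ r1) (res_irr _ r2).
Qed.

Lemma germs0D : left_id germs0 germsD.
Proof.
elim/quotW => s; rewrite !piE.
have r0 : pg_dom (pgD pg0 s) `<=` pg_dom s by move=> x [].
apply: (germsP (hs := @subset_refl _ _) (ht := r0)); first exact: pg_sub.
rewrite res_id /= raddf0 add0r.
exact: res_irr.
Qed.

Lemma germsND : left_inverse germs0 germsN germsD.
Proof.
elim/quotW => s; rewrite !piE.
have r0 : pg_dom s `<=` pg_dom (pgD (pgN s) s) by move=> x.
have r1 : pg_dom s `<=` pg_dom pg0 by move=> x.
apply: (germsP (hs := r0) (ht := r1)); first exact: pg_sub.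
rewrite /= raddf0 raddfD /= !raddfN !(res_comp _ _ (@subset_refl _ (pg_dom s))).
by rewrite addNr.
Qed.

HB.instance Definition _ :=
  GRing.isZmodule.Build germs germsDA germsDC germs0D germsND.

End Germs.

Section GermMap.
Variables (X : topologicalType) (F : presheaf X) (A : set X) (V : opens X).
Variable AV : A `<=` V.

Definition germ (s : F V) : germs F A := \pi_(germs F A) (Pregerm AV s).

Lemma germ_is_zmod_morphism : zmod_morphism germ.
Proof.
move=> s t; rewrite /germ.
rewrite -[RHS]/(germsD _ (germsN _)) !piE.
have r : V `<=` V by [].
have r0 : V `<=` pg_dom (pgD (Pregerm AV s) (pgN (Pregerm AV t))) by move=> x.
apply: (@germsP _ _ _ (Pregerm AV (s - t))
  (pgD (Pregerm AV s) (pgN (Pregerm AV t))) V r r0 AV).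
by rewrite raddfD /= raddfD /= !raddfN !(res_comp _ _ r).
Qed.
HB.instance Definition _ :=
  GRing.isZmodMorphism.Build (F V) (germs F A) germ germ_is_zmod_morphism.

End GermMap.

Section GermTheory.
Variables (X : topologicalType) (F : presheaf X) (A : set X).

Lemma germ_surj (g : germs F A) :
  exists (V : opens X) (AV : A `<=` V) (s : F V), g = germ AV s.
Proof.
elim/quotW: g => -[V AV s]; by exists V, AV, s.
Qed.

Lemma germ_res (V W : opens X) (AV : A `<=` V) (AW : A `<=` W)
  (h : W `<=` V) (s : F V) : germ AW (res F h s) = germ AV s.
Proof.
have r : W `<=` W by [].
apply: (@germsP _ _ _ (Pregerm AW (res F h s)) (Pregerm AV s) W r h AW).
by rewrite /= res_id.
Qed.

Lemma germ_eqP (V W : opens X) (AV : A `<=` V) (AW : A `<=` W)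
    (s : F V) (t : F W) : germ AV s = germ AW t <->
  exists (Z : opens X) (hs : Z `<=` V) (ht : Z `<=` W),
    A `<=` Z /\ res F hs s = res F ht t.
Proof.
split; first by move=> /eqmodP/asboolP.
move=> [Z [hs [ht [AZ e]]]].
exact: (@germsP _ _ _ (Pregerm AV s) (Pregerm AW t) Z hs ht AZ e).
Qed.

Lemma germ_surj2 (g h : germs F A) :
  exists (V : opens X) (AV : A `<=` V) (s t : F V),
    g = germ AV s /\ h = germ AV t.
Proof.
have [V [AV [s ->]]] := germ_surj g.
have [W [AW [t ->]]] := germ_surj h.
have AVW : A `<=` opensI V W by move=> x Ax; split; [exact: AV|exact: AW].
exists (opensI V W), AVW, (res F (@opensIl _ _ _) s), (res F (@opensIr _ _ _) t).
by rewrite !germ_res.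
Qed.

End GermTheory.

(* The canonical map between the direct limits, for [B] contained in [A]. *)
Section GermsRestriction.
Variables (X : topologicalType) (F : presheaf X) (A B : set X).
Variable BA : B `<=` A.

Definition germs_res (g : germs F A) : germs F B :=
  germ (subset_trans BA (@pg_sub _ _ _ (repr g))) (pg_val (repr g)).

Lemma germs_res_germ (V : opens X) (AV : A `<=` V) (s : F V) (BV : B `<=` V) :
  germs_res (germ AV s) = germ BV s.
Proof.
rewrite /germs_res; set g := repr _.
have /eqmodP/asboolP[W [hs [ht [AW e]]]] :
    g = Pregerm AV s %[mod germs F A] by rewrite reprK.
apply: (@germsP _ _ _ (Pregerm (subset_trans BA (@pg_sub _ _ _ g)) (pg_val g))
  (Pregerm BV s) W hs ht) => //.
exact: subset_trans BA AW.
Qed.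

Lemma germs_res_is_zmod_morphism : zmod_morphism germs_res.
Proof.
move=> g h; have [V [AV [s [t [-> ->]]]]] := germ_surj2 g h.
by rewrite -raddfB !(germs_res_germ _ _ (subset_trans BA AV)) raddfB.
Qed.
HB.instance Definition _ := GRing.isZmodMorphism.Build (germs F A) (germs F B)
  germs_res germs_res_is_zmod_morphism.

End GermsRestriction.

Section Stalks.
Variables (X : topologicalType) (F : presheaf X).

Definition stalk (x : X) : zmodType := germs F [set x].

Lemma set1_sub (U : set X) (x : X) : U x -> [set x] `<=` U.
Proof. by move=> Ux _ ->. Qed.

Definition germ_at (U : opens X) (x : X) (Ux : U x) :
    {additive F U -> stalk x} :=
  germ (set1_sub Ux).

Lemma germ_at_res (U V : opens X) (h : V `<=` U) (x : X) (Vx : V x) (Ux : U x)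
  (s : F U) : germ_at Vx (res F h s) = germ_at Ux s.
Proof. exact: germ_res. Qed.

End Stalks.
Arguments germ_at {X F U x} Ux.

(* The sheaf of discontinuous sections, V |-> \prod_(x in V) F_x. *)
Section DiscontinuousSections.
Variables (X : topologicalType) (F : presheaf X).

Definition dsect (U : opens X) : zmodType := pfam_of U (stalk F).

Section Res.
Variables (U V : opens X) (h : V `<=` U).
Definition dsect_res (s : dsect U) : dsect V := fun x Vx => s x (h Vx).
Lemma dsect_res_is_zmod_morphism : zmod_morphism dsect_res.
Proof. by []. Qed.
HB.instance Definition _ := GRing.isZmodMorphism.Build (dsect U) (dsect V)
  dsect_res dsect_res_is_zmod_morphism.
End Res.

Lemma dsect_res_id (U : opens X) (h : U `<=` U) (s : dsect U) :
  dsect_res h s = s.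
Proof.
by apply: pfamP => x Ux; rewrite /dsect_res (Prop_irrelevance (h x Ux) Ux).
Qed.

Lemma dsect_res_comp (U V W : opens X) (hVU : V `<=` U) (hWV : W `<=` V)
  (hWU : W `<=` U) (s : dsect U) :
  dsect_res hWV (dsect_res hVU s) = dsect_res hWU s.
Proof.
apply: pfamP => x Wx; rewrite /dsect_res.
by rewrite (Prop_irrelevance (hVU x (hWV x Wx)) (hWU x Wx)).
Qed.

Definition godement_presheaf : presheaf X :=
  @Presheaf X dsect (fun U V h => dsect_res h) dsect_res_id dsect_res_comp.

Lemma godement_is_sheaf : is_sheaf godement_presheaf.
Proof.
move=> U I V hV cov s comp.
have val x (Ux : U x) : exists a : stalk F x,
    forall i (Vx : V i x), s i x Vx = a.
  have [i _ Vix] := cov x Ux.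
  exists (s i x Vix) => j Vjx.
  have Wx : opensI (V j) (V i) x by split.
  have := congr1 (fun t : dsect (opensI (V j) (V i)) => t x Wx) (comp j i).
  rewrite /= /dsect_res => e.
  by rewrite (Prop_irrelevance Vjx (opensIl Wx))
    (Prop_irrelevance Vix (opensIr Wx)).
exists (fun x Ux => sval (cid (val x Ux))); split.
  move=> i; apply: pfamP => x Vx; rewrite /= /dsect_res.
  by case: cid => a /= ->.
move=> t ht; apply: pfamP => x Ux; case: cid => a /= ha.
have [i _ Vix] := cov x Ux.
rewrite -(ha i Vix) -(ht i) /= /dsect_res.
by rewrite (Prop_irrelevance (hV i x Vix) Ux).
Qed.

Definition godement : sheaf X := Sheaf godement_is_sheaf.

Section Unit.
Variable U : opens X.
Definition godement_unit_val (s : F U) : godement U :=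
  fun x Ux => germ_at Ux s.
Lemma godement_unit_is_zmod_morphism : zmod_morphism godement_unit_val.
Proof. by move=> s t; apply: pfamP => x Ux; exact: raddfB. Qed.
HB.instance Definition _ := GRing.isZmodMorphism.Build (F U) (godement U)
  godement_unit_val godement_unit_is_zmod_morphism.
End Unit.

Lemma godement_unit_res (U V : opens X) (h : V `<=` U) (s : F U) :
  godement_unit_val (res F h s) = res godement h (godement_unit_val s).
Proof. by apply: pfamP => x Vx; exact: germ_at_res. Qed.

Definition godement_unit : hom F godement :=
  @Hom _ F godement (fun U => @godement_unit_val U) godement_unit_res.

End DiscontinuousSections.

(* The associated sheaf: families of germs that are locally induced by a
   section of the presheaf. *)
Section Sheafification.
Variables (X : topologicalType) (P : presheaf X).

Definition locally_induced (U : opens X) (s : dsect P U) (x : X) : Prop :=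
  exists (V : opens X) (h : V `<=` U) (t : P V),
    V x /\ res (godement P) h s = godement_unit P V t.

Definition csect_pred (U : opens X) : {pred dsect P U} :=
  fun s => `[< forall x, U x -> locally_induced s x >].

Section Carrier.
Variable U : opens X.

Lemma csect_pred_zmod_closed : zmod_closed (@csect_pred U).
Proof.
split.
  apply/asboolP => x Ux; have h : U `<=` U by [].
  by exists U, h, 0; rewrite !raddf0.
move=> s t /asboolP hs /asboolP ht; apply/asboolP => x Ux.
have [V [hV [a [Vx ea]]]] := hs x Ux.
have [W [hW [b [Wx eb]]]] := ht x Ux.
have h : opensI V W `<=` U by move=> y [/hV].
exists (opensI V W), h, (res P (@opensIl _ _ _) a - res P (@opensIr _ _ _) b).
split=> //; rewrite !raddfB !hom_res -ea -eb.
by rewrite !(res_comp _ _ h).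
Qed.
HB.instance Definition _ := GRing.isZmodClosed.Build (dsect P U) (@csect_pred U)
  csect_pred_zmod_closed.

Record csect := Csect
  { csect_val : dsect P U; _ : csect_val \in @csect_pred U }.
HB.instance Definition _ := [isSub for csect_val].
HB.instance Definition _ := [Choice of csect by <:].
HB.instance Definition _ := [SubChoice_isSubZmodule of csect by <:].

Lemma csectP (s : csect) (x : X) : U x -> locally_induced (csect_val s) x.
Proof. by move=> Ux; case: s => s /= /asboolP; exact. Qed.

End Carrier.

Lemma csect_res_subproof (U V : opens X) (h : V `<=` U) (s : csect U) :
  res (godement P) h (csect_val s) \in @csect_pred V.
Proof.
apply/asboolP => x Vx; have [W [hW [t [Wx e]]]] := csectP s (h x Vx).
have k : opensI V W `<=` U by move=> y [/h].
exists (opensI V W), (@opensIl _ _ _), (res P (@opensIr _ _ _) t); split=> //.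
by rewrite hom_res -e !(res_comp _ _ k).
Qed.

Section Res.
Variables (U V : opens X) (h : V `<=` U).
Definition csect_res (s : csect U) : csect V := Csect (csect_res_subproof h s).
Lemma csect_res_is_zmod_morphism : zmod_morphism csect_res.
Proof. by move=> s t; apply: val_inj. Qed.
HB.instance Definition _ := GRing.isZmodMorphism.Build (csect U) (csect V)
  csect_res csect_res_is_zmod_morphism.
End Res.

Lemma csect_res_id (U : opens X) (h : U `<=` U) (s : csect U) :
  csect_res h s = s.
Proof. by apply: val_inj; exact: (@res_id _ (godement P)). Qed.

Lemma csect_res_comp (U V W : opens X) (hVU : V `<=` U) (hWV : W `<=` V)
  (hWU : W `<=` U) (s : csect U) :
  csect_res hWV (csect_res hVU s) = csect_res hWU s.
Proof. by apply: val_inj; exact: (@res_comp _ (godement P)). Qed.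

Definition sheafify_presheaf : presheaf X :=
  @Presheaf X csect (fun U V h => csect_res h) csect_res_id csect_res_comp.

Lemma sheafify_is_sheaf : is_sheaf sheafify_presheaf.
Proof.
move=> U I V hV cov s comp.
have comp' i j : res (godement P) (@opensIl _ (V i) (V j)) (csect_val (s i)) =
    res (godement P) (@opensIr _ (V i) (V j)) (csect_val (s j)).
  by have := congr1 (@csect_val _) (comp i j).
have [t [ht tu]] := @godement_is_sheaf _ P U I V hV cov _ comp'.
have ct : t \in @csect_pred U.
  apply/asboolP => x Ux; have [i _ Vix] := cov x Ux.
  have [W [hW [a [Wx e]]]] := csectP (s i) Vix.
  exists W, (subset_trans hW (hV i)), a; split=> //.
  by rewrite -e -ht (res_comp _ _ (subset_trans hW (hV i))).
exists (Csect ct); split.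
  by move=> i; apply: val_inj; exact: ht.
move=> t' ht'; apply: val_inj; apply: tu => i.
by rewrite -ht'.
Qed.

Definition sheafify : sheaf X := Sheaf sheafify_is_sheaf.

Lemma sheafify_unit_subproof (U : opens X) (s : P U) :
  godement_unit P U s \in @csect_pred U.
Proof.
apply/asboolP => x Ux; have h : U `<=` U by [].
by exists U, h, s; rewrite res_id.
Qed.

Section Unit.
Variable U : opens X.
Definition sheafify_unit_val (s : P U) : sheafify U :=
  Csect (sheafify_unit_subproof s).
Lemma sheafify_unit_is_zmod_morphism : zmod_morphism sheafify_unit_val.
Proof. by move=> s t; apply: val_inj; rewrite /= raddfB. Qed.
HB.instance Definition _ := GRing.isZmodMorphism.Build (P U) (sheafify U)
  sheafify_unit_val sheafify_unit_is_zmod_morphism.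
End Unit.

Lemma sheafify_unit_res (U V : opens X) (h : V `<=` U) (s : P U) :
  sheafify_unit_val (res P h s) = res sheafify h (sheafify_unit_val s).
Proof. by apply: val_inj; exact: (hom_res (godement_unit P)). Qed.

Definition sheafify_unit : hom P sheafify :=
  @Hom _ P sheafify (fun U => @sheafify_unit_val U) sheafify_unit_res.

End Sheafification.

(* The inverse image of a sheaf under a (continuous) map f: the sheaf
   associated with V |-> the limit of the F W over the open sets W containing
   f(V). *)
Section InverseImage.
Variables (X Y : topologicalType) (f : X -> Y) (F : sheaf Y).

Definition inverse_image_res (U V : opens X) (h : V `<=` U) :
    {additive germs F (f @` U) -> germs F (f @` V)} :=
  germs_res (image_subset f h).

Lemma inverse_image_res_id (U : opens X) (h : U `<=` U) s :
  inverse_image_res h s = s.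
Proof.
by have [V [AV [t ->]]] := germ_surj s; rewrite /= (germs_res_germ _ _ _ AV).
Qed.

Lemma inverse_image_res_comp (U V W : opens X) (hVU : V `<=` U)
  (hWV : W `<=` V) (hWU : W `<=` U) s :
  inverse_image_res hWV (inverse_image_res hVU s) = inverse_image_res hWU s.
Proof.
have [Z [AZ [t ->]]] := germ_surj s.
have h1 := subset_trans (image_subset f hVU) AZ.
have h2 := subset_trans (image_subset f hWU) AZ.
by rewrite /= (germs_res_germ _ _ _ h1) !(germs_res_germ _ _ _ h2).
Qed.

Definition inverse_image_presheaf : presheaf X :=
  @Presheaf X (fun U => germs F (f @` U)) inverse_image_res
    inverse_image_res_id inverse_image_res_comp.

Definition inverse_image : sheaf X := sheafify inverse_image_presheaf.

End InverseImage.

Section SheafCokernel.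
Variables (X : topologicalType) (F G : presheaf X) (phi : hom F G).

Definition pcoker (U : opens X) : zmodType := coker (phi U).

Section Res.
Variables (U V : opens X) (h : V `<=` U).

Definition pcoker_res (c : pcoker U) : pcoker V :=
  coker_proj (phi V) (res G h (repr c)).

Lemma pcoker_res_proj (s : G U) :
  pcoker_res (coker_proj (phi U) s) = coker_proj (phi V) (res G h s).
Proof.
have /coker_proj_eqP[x ex] :
    coker_proj (phi U) (repr (coker_proj (phi U) s)) = coker_proj (phi U) s.
  by rewrite /= reprK.
by apply/coker_proj_eqP; exists (res F h x); rewrite hom_res ex raddfB.
Qed.

Lemma pcoker_res_is_zmod_morphism : zmod_morphism pcoker_res.
Proof.
move=> c d.
have [s ->] := coker_proj_surj c; have [t ->] := coker_proj_surj d.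
by rewrite -raddfB !pcoker_res_proj !raddfB.
Qed.
HB.instance Definition _ := GRing.isZmodMorphism.Build (pcoker U) (pcoker V)
  pcoker_res pcoker_res_is_zmod_morphism.

End Res.

Lemma pcoker_res_id (U : opens X) (h : U `<=` U) (c : pcoker U) :
  pcoker_res h c = c.
Proof.
by have [s ->] := coker_proj_surj c; rewrite pcoker_res_proj res_id.
Qed.

Lemma pcoker_res_comp (U V W : opens X) (hVU : V `<=` U) (hWV : W `<=` V)
  (hWU : W `<=` U) (c : pcoker U) :
  pcoker_res hWV (pcoker_res hVU c) = pcoker_res hWU c.
Proof.
have [s ->] := coker_proj_surj c.
by rewrite !pcoker_res_proj (res_comp hVU hWV hWU).
Qed.

Definition coker_presheaf : presheaf X :=
  @Presheaf X pcoker (fun U V h => pcoker_res h) pcoker_res_id pcoker_res_comp.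

Lemma coker_presheaf_proj_res (U V : opens X) (h : V `<=` U) (s : G U) :
  coker_proj (phi V) (res G h s) = res coker_presheaf h (coker_proj (phi U) s).
Proof. by rewrite -pcoker_res_proj. Qed.

Definition coker_presheaf_proj : hom G coker_presheaf :=
  @Hom _ G coker_presheaf (fun U => coker_proj (phi U)) coker_presheaf_proj_res.

Definition sheaf_coker : sheaf X := sheafify coker_presheaf.

Definition sheaf_coker_proj : hom G sheaf_coker :=
  hom_comp (sheafify_unit coker_presheaf) coker_presheaf_proj.

Lemma sheaf_coker_proj_im (U : opens X) (x : F U) :
  sheaf_coker_proj U (phi U x) = 0.
Proof.
transitivity (sheafify_unit coker_presheaf U (coker_proj (phi U) (phi U x))).
  by [].
by rewrite coker_proj_im; exact: raddf0.
Qed.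

End SheafCokernel.

(* The canonical flabby resolution 0 -> F -> C^0 -> C^1 -> ..., obtained by
   splicing 0 -> Z^p -> C^p -> Z^{p+1} -> 0, where Z^0 = F and C^p is the sheaf
   of discontinuous sections of Z^p. *)
Section Cohomology.
Variables (X : topologicalType) (F : sheaf X).

Fixpoint godement_syzygy (p : nat) : sheaf X :=
  if p is q.+1 then sheaf_coker (godement_unit (godement_syzygy q)) else F.

Definition godement_resolution (p : nat) : sheaf X :=
  godement (godement_syzygy p).

Definition godement_diff (p : nat) :
    hom (godement_resolution p) (godement_resolution p.+1) :=
  hom_comp (godement_unit (godement_syzygy p.+1))
    (sheaf_coker_proj (godement_unit (godement_syzygy p))).

Definition global_diff (p : nat) :
    {additive godement_resolution p (opensT X) ->
              godement_resolution p.+1 (opensT X)} :=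
  godement_diff p (opensT X).

Lemma godement_diff_comp (p : nat) (U : opens X)
  (s : godement_resolution p U) :
  godement_diff p.+1 U (godement_diff p U s) = 0.
Proof.
set Z := godement_syzygy p.
set t : godement_syzygy p.+1 U := sheaf_coker_proj (godement_unit Z) U s.
transitivity (godement_unit (godement_syzygy p.+2) U
    (sheaf_coker_proj (godement_unit (godement_syzygy p.+1)) U
      (godement_unit (godement_syzygy p.+1) U t))); first by [].
by rewrite sheaf_coker_proj_im raddf0.
Qed.

(* H^p(X, F); the complex is extended by 0 in negative degrees. *)
Definition sheaf_cohomology (p : nat) : zmodType :=
  if p is q.+1 then homology (global_diff q) (global_diff q.+1)
  else homology (\0 : {additive godement_resolution 0 (opensT X) ->
                                godement_resolution 0 (opensT X)})
                (global_diff 0).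

End Cohomology.

(* The restriction to A of a sheaf defined on a larger set W. *)
Definition sheaf_restriction (X : topologicalType) (A W : set X)
    (AW : A `<=` W) (F : sheaf W) : sheaf A :=
  inverse_image (subfun AW) F.

Definition closed_cube (R : realType) (n : nat) (a b : 'rV[R]_n) :
    set 'rV[R]_n :=
  [set x | forall i, a ord0 i <= x ord0 i <= b ord0 i].

(* Main.v *)
(* Let 0 -> Z^q -> C^q -> Z^{q+1} -> 0, with Z^0 = F, be the short exact
   sequences of the canonical flabby resolution; H^{q+1}(X, F) = 0 as soon as
   every section of Z^{q+1} lifts to C^q.  Call a subset A of X acyclic at q if
   every section of Z^{q+1} near A lifts to C^q near A.  Points are acyclic at
   every q.  If A is compact and all fibers on A of a continuous real function
   are acyclic at q and q+1, then A is acyclic at q+1: by compactness a section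
   of Z^{q+2} lifts over a slab around each fiber, and the lifts over two
   adjacent slabs differ near their common fiber by a section of Z^{q+1}, whose
   lift to C^q extends to X by flabbiness and can be used to match them.  By
   induction on the number of coordinates that separate the points of A, a
   compact subset of R^n is acyclic at every q >= n. *)
Require Import Defs.
From mathcomp Require Import all_boot all_order all_algebra.
From mathcomp Require Import all_classical all_reals all_analysis.
From mathcomp Require Import lra.

Set Implicit Arguments.
Unset Strict Implicit.
Unset Printing Implicit Defensive.

Import Order.TTheory GRing.Theory Num.Theory.
Import numFieldNormedType.Exports.
Local Open Scope classical_set_scope.
Local Open Scope ring_scope.

(** * Gluing, flabbiness, and exactness of the sheaf cokernel *)

Section Sheaves.
Variable X : topologicalType.

(** Both sections glue one and the same family, indexed by the open sets on which they agree, so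
    uniqueness in the sheaf axiom identifies them. *)
Lemma sheaf_separated (F : sheaf X) (U : opens X) (s t : F U) :
  (forall x, U x -> exists (V : opens X) (h : V `<=` U),
     V x /\ res _ h s = res _ h t) -> s = t.
Proof.
move=> loc.
pose I := {V : opens X | exists h : V `<=` U, res _ h s = res _ h t}.
have hV (i : I) : sval i `<=` U by case: i => V [h].
have cov : U `<=` \bigcup_(i : I) (sval i : opens X).
  move=> x Ux; have [V [h [Vx e]]] := loc x Ux.
  by exists (exist _ V (ex_intro _ h e)).
have comp (i j : I) :
    res _ (@opensIl _ (sval i) (sval j)) (res _ (hV i) s) =
    res _ (@opensIr _ (sval i) (sval j)) (res _ (hV j) s).
  have h : opensI (sval i) (sval j) `<=` U by move=> y [/hV].
  by rewrite !(res_comp _ _ h).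
have [u [_ uu]] := sheafP hV cov comp.
rewrite -(uu s) // -(uu t) // => i.
case: i (hV i) => V [h e] /= h'.
by rewrite !(res_irr h' h) e.
Qed.

Lemma sheaf_empty (F : sheaf X) (U : opens X) (s t : F U) :
  U `<=` set0 -> s = t.
Proof. by move=> U0; apply: sheaf_separated => x /U0. Qed.

Lemma sheaf_glue2 (F : sheaf X) (U V : opens X) (s : F U) (t : F V) :
  res _ (@opensIl _ U V) s = res _ (@opensIr _ U V) t ->
  exists (W : opens X) (hU : U `<=` W) (hV : V `<=` W) (u : F W),
    [/\ W `<=` (U : set X) `|` V, res _ hU u = s & res _ hV u = t].
Proof.
move=> e.
pose W := Opens (openU (carrier_open U) (carrier_open V)).
pose B (b : bool) := if b then U else V.
pose f (b : bool) : F (B b) := if b return F (B b) then s else t.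
have hB b : B b `<=` W by case: b; [left|right].
have cov : W `<=` \bigcup_b (B b) by move=> x [] ?; [exists true|exists false].
have comp b c : res _ (@opensIl _ (B b) (B c)) (f b) =
    res _ (@opensIr _ (B b) (B c)) (f c).
  case: b; case: c => //=; try exact: res_irr.
  (* The sheaf axiom asks for agreement in both orders of the pair; the reversed order follows by
     restricting [e] along [k]. *)
  have k : opensI V U `<=` opensI U V by move=> x [].
  have := congr1 (res _ k) e.
  rewrite (res_comp _ _ (@opensIr _ V U)) (res_comp _ _ (@opensIl _ V U)).
  by move->.
have [u [hu _]] := sheafP hB cov comp.
exists W, (hB true), (hB false), u; split=> //.
  exact: hu true.
exact: hu false.
Qed.

Lemma germ_at_eqP (F : presheaf X) (U : opens X) (x : X) (Ux : U x)
    (s t : F U) : germ_at Ux s = germ_at Ux t ->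
  exists (V : opens X) (h : V `<=` U), V x /\ res _ h s = res _ h t.
Proof.
move=> /germ_eqP[V [h [h' [xV e]]]]; exists V, h; split; first exact: xV.
by rewrite e; exact: res_irr.
Qed.

Lemma godement_unit_inj (F : sheaf X) (U : opens X) :
  injective (godement_unit F U).
Proof.
move=> s t e; apply: sheaf_separated => x Ux.
apply: (germ_at_eqP (Ux := Ux)).
exact: (congr1 (fun u : dsect F U => u x Ux) e).
Qed.

Lemma godement_flabby (F : presheaf X) (U : opens X) (s : godement F U) :
  exists t : godement F (opensT X),
    res _ (@subsetT _ U : U `<=` opensT X) t = s.
Proof.
exists (fun x _ => if pselect (U x) is left Ux then s x Ux else 0).
apply: pfamP => x Ux /=; rewrite /dsect_res; case: pselect => // Ux'.
by rewrite (Prop_irrelevance Ux' Ux).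
Qed.

(** A section of an associated sheaf is locally induced by the presheaf, here by a class that is
    represented by a section of [G]. *)
Lemma sheaf_coker_proj_locally_surj (F G : presheaf X) (phi : Defs.hom F G)
    (U : opens X) (s : sheaf_coker phi U) (x : X) : U x ->
  exists (V : opens X) (h : V `<=` U) (t : G V),
    V x /\ sheaf_coker_proj phi V t = res _ h s.
Proof.
move=> Ux; have [V [h [c [Vx e]]]] := csectP s Ux.
have [t et] := coker_proj_surj c.
exists V, h, t; split=> //; apply: val_inj => /=.
by rewrite /= in e; rewrite e et.
Qed.

(** Vanishing germs in the presheaf cokernel give local preimages of [g]; injectivity of [phi] makes
    these agree on overlaps, hence glue. *)
Lemma sheaf_coker_proj_ker (F G : sheaf X) (phi : Defs.hom F G) (U : opens X)
    (g : G U) : (forall V : opens X, injective (phi V)) ->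
  sheaf_coker_proj phi U g = 0 -> exists f, phi U f = g.
Proof.
move=> inj e.
have loc x : U x -> exists (V : opens X) (h : V `<=` U) (f : F V),
    V x /\ phi V f = res _ h g.
  move=> Ux.
  have e0 : germ_at Ux (coker_proj (phi U) g : coker_presheaf phi U) =
      germ_at Ux 0.
    rewrite raddf0.
    exact: (congr1 (fun u : csect (coker_presheaf phi) U => csect_val u Ux) e).
  have [V [h [Vx]]] := germ_at_eqP e0.
  rewrite raddf0 -coker_presheaf_proj_res -(raddf0 (coker_proj (phi V))).
  by move=> /coker_proj_eqP[f]; rewrite subr0 => ef; exists V, h, f.
pose I := {x | U x}.
pose V (i : I) : opens X := sval (cid (loc _ (svalP i))).
have hf (i : I) : exists (h : V i `<=` U) (f : F (V i)),
    V i (sval i) /\ phi (V i) f = res _ h g.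
  exact: svalP (cid (loc _ (svalP i))).
pose hV i : V i `<=` U := sval (cid (hf i)).
have hf' i : exists f : F (V i), V i (sval i) /\ phi (V i) f = res _ (hV i) g.
  exact: svalP (cid (hf i)).
pose f i : F (V i) := sval (cid (hf' i)).
have fP i : V i (sval i) /\ phi (V i) (f i) = res _ (hV i) g.
  exact: svalP (cid (hf' i)).
have cov : U `<=` \bigcup_i V i.
  by move=> x Ux; exists (exist _ x Ux) => //; exact: (fP (exist _ x Ux)).1.
have comp i j : res _ (@opensIl _ (V i) (V j)) (f i) =
    res _ (@opensIr _ (V i) (V j)) (f j).
  apply: inj; rewrite !hom_res (fP i).2 (fP j).2.
  have h : opensI (V i) (V j) `<=` U by move=> y [/hV].
  by rewrite !(res_comp _ _ h).
have [t [ht _]] := sheafP hV cov comp.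
exists t; apply: sheaf_separated => x Ux.
exists (V (exist _ x Ux)), (hV _); split; first exact: (fP (exist _ x Ux)).1.
by rewrite -hom_res ht (fP _).2.
Qed.

End Sheaves.

(** * Gluing of lifts along two sets *)

Section Lifting.
Variable X : topologicalType.

Lemma resB (F : presheaf X) (U V : opens X) (h : V `<=` U) (s t : F U) :
  res F h (s - t) = res F h s - res F h t.
Proof. exact: raddfB. Qed.

Lemma homB (F G : presheaf X) (phi : Defs.hom F G) (U : opens X) (s t : F U) :
  phi U (s - t) = phi U s - phi U t.
Proof. exact: raddfB. Qed.

Definition lifts_on (F G : sheaf X) (phi : Defs.hom F G) (V : opens X)
    (s : G V) (A : set X) :=
  exists (U : opens X) (h : U `<=` V) (t : F U),
    A `<=` U /\ phi U t = res G h s.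

Definition surj_along (F G : sheaf X) (phi : Defs.hom F G) (A : set X) :=
  forall (V : opens X) (s : G V), A `<=` V -> lifts_on phi s A.

(* The difference of the lifts on A and B is a section z of K near A `&` B;
   lifting z to L and extending the lift to all of X corrects the lift on A so
   that it agrees with the one on B. *)
Lemma lifts_on_glue (L K F G : sheaf X) (delta : Defs.hom L K)
    (iota : Defs.hom K F) (phi : Defs.hom F G) :
  (forall (U : opens X) (s : L U),
     exists t : L (opensT X), res L (@subsetT _ U : U `<=` opensT X) t = s) ->
  (forall (U : opens X) (z : K U), phi U (iota U z) = 0) ->
  (forall (U : opens X) (t : F U), phi U t = 0 -> exists z, iota U z = t) ->
  forall (V : opens X) (s : G V) (A B M N : set X),
  open M -> open N -> M `&` N `<=` set0 ->
  A `<=` M `|` (A `&` B) -> B `<=` N `|` (A `&` B) ->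
  surj_along delta (A `&` B) -> lifts_on phi s A -> lifts_on phi s B ->
  lifts_on phi s (A `|` B).
Proof.
move=> flabL phi_iota kerphi V s A B M N oM oN MN AM BN surjAB.
move=> [U [hU [t [AU et]]]] [U' [hU' [t' [BU' et']]]].
pose UU := opensI U U'.
have hUU : UU `<=` V by move=> x [/hU].
have [z ez] : exists z, iota UU z =
    res _ (@opensIl _ U U') t - res _ (@opensIr _ U U') t'.
  apply: kerphi.
  by rewrite homB !hom_res et et' !(res_comp _ _ hUU) subrr.
have ABUU : A `&` B `<=` UU by move=> x [/AU ? /BU' ?].
have [W [hW [u [ABW eu]]]] := surjAB UU z ABUU.
have [v ev] := flabL W u.
pose t1 := t - res F (@subsetT _ U : U `<=` opensT X) (iota _ (delta _ v)).
have et1 : phi U t1 = res _ hU s.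
  by rewrite homB hom_res phi_iota raddf0 subr0.
have WU : W `<=` U by move=> x /hW[].
have WU' : W `<=` U' by move=> x /hW[].
have e1 : res _ WU t1 = res _ WU' t'.
  rewrite resB (res_comp _ _ (@subsetT _ W : W `<=` opensT X)).
  rewrite -!hom_res ev eu hom_res ez resB.
  by rewrite (res_comp _ _ WU) (res_comp _ _ WU') opprB addrC subrK.
(* Away from their intersection, [A] and [B] lie in the disjoint open sets [M] and [N]. Cutting the
   domains down accordingly leaves an overlap inside [W], where the lifts agree. *)
pose P := Opens (openI (carrier_open U) (openU oM (carrier_open W))).
pose P' := Opens (openI (carrier_open U') (openU oN (carrier_open W))).
have hP : P `<=` U by move=> x [].
have hP' : P' `<=` U' by move=> x [].
have PPW : opensI P P' `<=` W.
  by move=> x [[_ [Mx|//]] [_ [Nx|//]]]; case: (MN x).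
have e2 : res _ (@opensIl _ P P') (res _ hP t1) =
    res _ (@opensIr _ P P') (res _ hP' t').
  have h1 := subset_trans PPW WU; have h2 := subset_trans PPW WU'.
  rewrite (res_comp _ _ h1) (res_comp _ _ h2).
  by rewrite -(res_comp WU PPW) -(res_comp WU' PPW) e1.
have [Q [hQ [hQ' [r [QPP er er']]]]] := sheaf_glue2 e2.
have QV : Q `<=` V by move=> x /QPP[/hP/hU|/hP'/hU'].
exists Q, QV, r; split.
  move=> x [Ax|Bx].
    apply: (hQ x); split; first exact: AU.
    by case: (AM x Ax); [left|right; exact: ABW].
  apply: (hQ' x); split; first exact: BU'.
  by case: (BN x Bx); [left|right; exact: ABW].
apply: sheaf_separated => x /QPP[Px|Px].
  exists P, hQ; split=> //; have PV := subset_trans hP hU.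
  rewrite -hom_res er hom_res et1.
  by rewrite (res_comp _ _ PV) (res_comp _ _ PV).
exists P', hQ'; split=> //; have PV := subset_trans hP' hU'.
rewrite -hom_res er' hom_res et'.
by rewrite (res_comp _ _ PV) (res_comp _ _ PV).
Qed.

End Lifting.

(** * From acyclicity to vanishing cohomology *)

Lemma homology_eq0 (A B C : zmodType) (f : {additive A -> B})
    (g : {additive B -> C}) :
  (forall y, g y = 0 -> exists x, f x = y) -> forall c : homology f g, c = 0.
Proof.
move=> ex c; rewrite -[c]reprK -[RHS]reprK; apply/eqmodP.
have /eqP/ex[x ex'] : g (\val (repr c - repr (0 : homology f g))) == 0.
  exact: valP (repr c - repr (0 : homology f g)).
by apply/asboolP; exists x.
Qed.

Section Acyclicity.
Variables (X : topologicalType) (F : sheaf X).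
Notation Z := (godement_syzygy F).

Definition syzygy_proj (q : nat) : Defs.hom (godement (Z q)) (Z q.+1) :=
  sheaf_coker_proj (godement_unit (Z q)).

(* H^{q+1}(A, F) = 0, with germs along A as sections over A. *)
Definition acyclic_at (q : nat) (A : set X) := surj_along (syzygy_proj q) A.

Lemma syzygy_proj_unit (q : nat) (U : opens X) (z : Z q U) :
  syzygy_proj q U (godement_unit (Z q) U z) = 0.
Proof. exact: sheaf_coker_proj_im. Qed.

Lemma syzygy_proj_ker (q : nat) (U : opens X) (t : godement (Z q) U) :
  syzygy_proj q U t = 0 -> exists z, godement_unit (Z q) U z = t.
Proof.
apply: (@sheaf_coker_proj_ker _ (Z q) (godement (Z q))).
exact: godement_unit_inj.
Qed.

Lemma acyclic_at_point (q : nat) (A : set X) :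
  (forall x y, A x -> A y -> x = y) -> acyclic_at q A.
Proof.
move=> A1 V s AV; have [[x Ax]|/set0P/negP/negPn/eqP A0] := pselect (A !=set0).
  have [U [h [t [Ux e]]]] := sheaf_coker_proj_locally_surj s (AV x Ax).
  by exists U, h, t; split=> // y Ay; rewrite (A1 y x).
(* Fibers may be empty; then the zero section over the empty open set is a lift. *)
pose O : opens X := Opens open0.
have OV : O `<=` V by [].
by exists O, OV, 0; split; [rewrite A0|exact: sheaf_empty].
Qed.

Lemma syzygy_lifts_on_glue (q : nat) (V : opens X) (s : Z q.+2 V)
    (A B M N : set X) :
  open M -> open N -> M `&` N `<=` set0 ->
  A `<=` M `|` (A `&` B) -> B `<=` N `|` (A `&` B) ->
  acyclic_at q (A `&` B) -> lifts_on (syzygy_proj q.+1) s A ->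
  lifts_on (syzygy_proj q.+1) s B -> lifts_on (syzygy_proj q.+1) s (A `|` B).
Proof.
apply: (lifts_on_glue (delta := syzygy_proj q)
  (iota := godement_unit (Z q.+1)) (phi := syzygy_proj q.+1)).
- by move=> U t; exact: godement_flabby.
- by move=> U z; exact: syzygy_proj_unit.
- by move=> U t; exact: syzygy_proj_ker.
Qed.

Lemma acyclic_at_setT (q : nat) (z : Z q.+1 (opensT X)) :
  acyclic_at q [set: X] -> exists v, syzygy_proj q (opensT X) v = z.
Proof.
move=> /(_ (opensT X) z (@subset_refl _ _))[U [h [t [TU et]]]].
(* [U] has all points of [X] but need not be the term [opensT X]; flabbiness moves the lift
   there. *)
have [v ev] := godement_flabby t; exists v.
apply: sheaf_separated => x _; exists U, h; split; first exact: TU.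
by rewrite -et -ev -hom_res; congr (syzygy_proj q U _); exact: res_irr.
Qed.

(** The differential is a projection followed by an injective unit, so a cocycle in C^{q+1} comes
    from a section of Z^{q+1}; a lift of that section to C^q bounds the cocycle. *)
Lemma sheaf_cohomology_acyclic (q : nat) (c : sheaf_cohomology F q.+1) :
  acyclic_at q [set: X] -> c = 0.
Proof.
move=> ac; apply: homology_eq0 => y dy.
have [|z <-] := @syzygy_proj_ker q.+1 (opensT X) y.
  apply: (@godement_unit_inj _ (Z q.+2)); rewrite [RHS]raddf0; exact: dy.
have [v <-] := acyclic_at_setT z ac.
by exists v.
Qed.

End Acyclicity.

(** * Compactness arguments on the real line *)

Section Interval.
Variable R : realType.

(** Stands in for a finite subdivision of the interval: the set of [x] with [Q a x] can be continued
    past its supremum unless it reaches [b]. *)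
Lemma interval_induction (Q : R -> R -> Prop) (a b : R) : a <= b ->
  (forall c, exists2 e, 0 < e &
     forall u v, c - e < u -> u <= v -> v < c + e -> Q u v) ->
  (forall u v w, u <= v -> v <= w -> Q u v -> Q v w -> Q u w) ->
  Q a b.
Proof.
move=> ab loc trans.
pose S := [set x | a <= x <= b /\ Q a x].
have Sa : S a.
  split; first by rewrite lexx.
  by have [e e0] := loc a; apply; rewrite ?lexx// ?ltrBlDr ltrDl.
have supS : has_sup S.
  by split; [exists a|exists b => x [/andP[]]].
have [e e0 he] := loc (sup S).
have [x Sx ltx] := sup_adherent e0 supS.
have [/andP[ax xb] Qax] := Sx.
have lex : x <= sup S by exact: sup_upper_bound.
(* [v] will lie in [S], hence not beyond [sup S], which forces the minimum to be [b]. *)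
pose v := Num.min b (sup S + e / 2).
have xv : x <= v by rewrite le_min xb; lra.
have Sv : S v.
  split; first by rewrite (le_trans ax xv) ge_min lexx.
  apply: (trans _ x) => //; apply: he => //.
  by rewrite gt_min; apply/orP; right; lra.
have : v <= sup S by exact: sup_upper_bound.
rewrite ge_min => /orP[bS|]; last by lra.
suff -> : b = v by case: Sv.
by apply/esym/min_idPl; lra.
Qed.

(** The image under [f] of the part of [A] outside [U] is compact, hence closed, and misses [c]; so
    it misses a ball around [c]. *)
Lemma compact_fiber_nbhs (X : topologicalType) (f : X -> R) (A U : set X)
    (c : R) : continuous f -> compact A -> open U ->
  A `&` [set x | f x = c] `<=` U ->
  exists2 e, 0 < e & forall x, A x -> `|f x - c| < e -> U x.
Proof.
move=> cf cA oU AU.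
have cAU : compact (A `&` ~` U).
  by apply: compact_closedI => //; exact: open_closedC.
have : open (~` (f @` (A `&` ~` U))).
  apply: closed_openC; apply: compact_closed; first exact: Rhausdorff.
  by apply: continuous_compact => //; exact: continuous_subspaceT.
rewrite openE => /(_ c)[].
  by move=> [x [Ax nUx] fx]; apply: nUx; apply: AU.
move=> e /= e0 he; exists e => // x Ax fxc.
apply: contrapT => nUx; apply: (he (f x)); last by exists x.
by rewrite /ball/= distrC.
Qed.

End Interval.

(** * Induction on the number of separating functions *)

Section Dimension.
Variables (R : realType) (X : topologicalType) (F : sheaf X).
Notation Z := (godement_syzygy F).

Lemma acyclic_at_fibers (q : nat) (f : X -> R) (A : set X) :
  continuous f -> compact A ->
  (forall c, acyclic_at F q (A `&` [set x | f x = c])) ->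
  (forall c, acyclic_at F q.+1 (A `&` [set x | f x = c])) ->
  acyclic_at F q.+1 A.
Proof.
move=> cf cA acq acq1 V s AV.
have [M fM] : exists M, forall x, A x -> `|f x| <= M.
  have [M [_ hM]] := compact_bounded (continuous_compact
    (continuous_subspaceT cf) cA).
  by exists (M + 1) => x Ax; apply: (hM (M + 1)); [lra|exists x].
pose slab u v := A `&` [set x | u <= f x <= v].
(* If [A] is empty, [M] may be negative; its absolute value keeps the end points in order. *)
have -> : A = slab (- `|M|) `|M|.
  apply/seteqP; split=> [x Ax|x []//]; split=> //=.
  by rewrite -ler_norml (le_trans (fM x Ax)) // ler_norm.
pose lifts u v := lifts_on (syzygy_proj F q.+1) s (slab u v).
apply: (@interval_induction _ lifts).
- by rewrite (@le_trans _ _ 0) ?oppr_le0.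
- move=> c.
  have [|U [h [t [AU et]]]] := acq1 c V s; first by move=> x [/AV].
  have [e e0 he] := compact_fiber_nbhs cf cA (carrier_open U) AU.
  exists e => // u v cu uv vc; exists U, h, t; split=> // x [Ax /andP[ux xv]].
  by apply: he => //; rewrite ltr_distl; apply/andP; split; lra.
- rewrite {}/lifts => u v w uv vw luv lvw.
  have -> : slab u w = slab u v `|` slab v w.
    apply/seteqP; split=> x.
    + by move=> [Ax /andP[ux xw]]; case: (leP (f x) v) => [xv|/ltW vx];
        [left|right]; split=> //; apply/andP.
    + move=> [[Ax /andP[ux xv]]|[Ax /andP[vx xw]]].
        by split=> //=; rewrite ux (le_trans xv).
      by split=> //=; rewrite xw (le_trans uv).
  have slabI : slab u v `&` slab v w = A `&` [set x | f x = v].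
    apply/seteqP; split=> [x [[Ax /andP[_ xv]] [_ /andP[vx _]]]|x [Ax /= xv]].
      by split=> //; apply/eqP; rewrite /= eq_le xv vx.
    by split; split=> //=; rewrite xv ?lexx ?uv ?vw.
  (* The two strict sides of the level [v] separate the slabs away from their common fiber. *)
  apply: (@syzygy_lifts_on_glue _ _ _ _ _ _ _
    (f @^-1` [set y | y < v]) (f @^-1` [set y | v < y])) => //;
    rewrite ?slabI //.
  + by apply: open_comp => //; exact: open_lt.
  + by apply: open_comp => //; exact: open_gt.
  + by move=> x [/= xv vx]; have := lt_trans xv vx; rewrite ltxx.
  + by move=> x [Ax /andP[_]]; rewrite le_eqVlt => /orP[/eqP|];
      [right|left].
  + by move=> x [Ax /andP[+ _]]; rewrite le_eqVlt => /orP[/eqP|];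
      [right|left].
Qed.

Lemma acyclic_at_compact (k : nat) (f : nat -> X -> R) (A : set X) (q : nat) :
  (forall i, continuous (f i)) -> compact A ->
  (forall x y, A x -> A y -> (forall i, (i < k)%N -> f i x = f i y) -> x = y) ->
  (k <= q)%N -> acyclic_at F q A.
Proof.
move=> cf; elim: k A q => [|k IH] A q cA inj kq.
  by apply: acyclic_at_point => x y Ax Ay; exact: inj.
case: q kq => // q kq.
(* On a fiber of [f k] the first [k] functions still separate points. The degree stays free because
   both [q] and [q.+1] are needed. *)
have fiber c q' : (k <= q')%N -> acyclic_at F q' (A `&` [set x | f k x = c]).
  apply: IH.
    apply: compact_closedI => //.
    apply: (@preimage_closed _ _ (f k) [set y | y = c]).
      by move=> x _; exact: cf.
    exact: closed_eq.
  move=> x y [Ax fx] [Ay fy] e; apply: inj => // i.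
  by rewrite ltnS leq_eqVlt => /orP[/eqP->|/e//]; rewrite fx fy.
by apply: (acyclic_at_fibers (cf k) cA) => c; apply: fiber => //; exact: leqW.
Qed.

End Dimension.

(** * Compactness of the cube and the vanishing theorem *)

Lemma compact_set_type (T : topologicalType) (A : set T) :
  compact A -> compact [set: A].
Proof.
move=> cA G PG _.
have [|a [Aa Ga]] := cA (set_val @ G) (fmap_proper_filter _ PG).
  suff : G (set_val @^-1` A) by [].
  by apply: filterS filterT => x _; exact: set_valP.
(* Open sets of the subtype are traces of open sets of [T], so a cluster point of the image filter
   is one of [G]. *)
exists (exist _ a (mem_set Aa)); split=> // P Q GP [_ [[W oW <-] Wa WQ]].
have [|_ [[x Px <-] Wx]] := Ga (set_val @` P) W _ (open_nbhs_nbhs (conj oW Wa)).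
  suff : G (set_val @^-1` (set_val @` P)) by [].
  by apply: filterS GP => x Px; exists x.
by exists x; split=> //; exact: WQ.
Qed.

Lemma compact_closed_cube (R : realType) (n : nat) (a b : 'rV[R]_n) :
  compact (closed_cube a b).
Proof.
have -> : closed_cube a b =
    [set v : 'rV[R]_n | forall i, `[a ord0 i, b ord0 i]%classic (v ord0 i)].
  by apply/seteqP; split=> v h i; have := h i; rewrite /= in_itv.
apply: (@rV_compact R n (fun i => `[a ord0 i, b ord0 i]%classic)) => i.
exact: segment_compact.
Qed.

Theorem theorem3p2 (R : realType) (n : nat) (a b : 'rV[R]_n)
    (hab : forall i : 'I_n, a ord0 i < b ord0 i)
    (W : set 'rV[R]_n) (hW : closed_cube a b `<=` interior W) (F : sheaf W)
    (p : nat) (hp : (n < p)%N)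
    (c : sheaf_cohomology
           (sheaf_restriction (subset_trans hW (@interior_subset _ W)) F) p) :
  c = 0.
Proof.
(* Degree [p.+1] corresponds to acyclicity at [p], and [np] now says that [n] is at most [p]. *)
case: p hp c => // p np c.
apply: sheaf_cohomology_acyclic.
(* The coordinates, continued by the constant 0 from index [n] on so that every [f i] is
   continuous. *)
pose f (i : nat) (x : closed_cube a b) : R :=
  if insub i is Some j then (set_val x : 'rV[R]_n) ord0 j else 0.
apply: (@acyclic_at_compact R _ _ n f) => //.
- move=> i; rewrite /f; case: insubP => [j _ _|_]; last exact: cst_continuous.
  move=> x.
  apply: (@continuous_comp _ _ _ set_val (fun v : 'rV[R]_n => v ord0 j)).
    exact: initial_continuous.
  exact: coord_continuous.
- exact: compact_set_type (@compact_closed_cube R n a b).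
- move=> x y _ _ e; apply: val_inj; apply/rowP => j.
  by have := e j (ltn_ord j); rewrite /f valK.
Qed.
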